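(* Let $r,t,s$ be non-negative integers with $r+t>0$ and let $\varepsilon\in\{1,-1\}$. Then, as formal power series in $q$, \[\sum_{\pi\in\mathcal{D}} (-1)^{\lceil\mathcal{E}\rceil(\pi)}\varepsilon^{\lfloor\mathcal{E}\rfloor(\pi)} q^{r\lceil\mathcal{O}\rceil(\pi)+t\lfloor\mathcal{O}\rfloor(\pi)+s\lfloor\mathcal{E}\rfloor(\pi)} = (-q^r;-\varepsilon q^{r+t+s})_\infty,\] \[\sum_{\pi\in\mathcal{P}} (-1)^{\lceil\mathcal{E}\rceil(\pi)}\varepsilon^{\lfloor\mathcal{E}\rfloor(\pi)} q^{r\lceil\mathcal{O}\rceil(\pi)+t\lfloor\mathcal{O}\rfloor(\pi)+s\lfloor\mathcal{E}\rfloor(\pi)} = \frac{1}{(-\varepsilon q^{r+t+s};-\varepsilon q^{r+t+s})_\infty}.\]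
   Context: A partition $\pi=(\lambda_1,\lambda_2,\dots)$ is a finite non-increasing sequence of positive integers; the empty sequence is the unique partition of $0$. $\mathcal{P}$ is the set of all partitions, $\mathcal{D}$ the set of partitions into distinct parts. $\lceil\mathcal{O}\rceil(\pi)=\sum_{i\ge1}\lceil\lambda_{2i-1}/2\rceil$, $\lfloor\mathcal{O}\rfloor(\pi)=\sum_{i\ge1}\lfloor\lambda_{2i-1}/2\rfloor$, $\lceil\mathcal{E}\rceil(\pi)=\sum_{i\ge1}\lceil\lambda_{2i}/2\rceil$, $\lfloor\mathcal{E}\rfloor(\pi)=\sum_{i\ge1}\lfloor\lambda_{2i}/2\rfloor$. $(a;q)_\infty=\prod_{i\ge0}(1-aq^i)$.
   Formalization: For r=0 the second sum is not defined as a formal power series (each partition 1,...,1 contributes ±1 to the constant term), so there it is taken by first summing over partitions with a given value of ⌈O⌉(π); the first identity, and the second for r>0, are as stated. *)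

(* Defs.v *)
From HB Require Import structures.
From mathcomp Require Import all_boot all_order all_algebra.
From mathcomp Require Import all_classical.

Set Implicit Arguments.
Unset Strict Implicit.
Unset Printing Implicit Defensive.

Import GRing.Theory.
Local Open Scope classical_set_scope.
Local Open Scope ring_scope.

(* Z[[q]]: [f n] is the coefficient of q^n; addition is pointwise. *)
Definition fps := nat -> int.

HB.instance Definition _ := GRing.Zmodule.copy fps (nat -> int).

Definition fps1 : fps := fun n => (n == 0%N)%:R.

Definition fps_mul (f g : fps) : fps :=
  fun n => \sum_(i < n.+1) f i * g (n - i)%N.

Definition fps_trunc (m : nat) (f : fps) : {poly int} := \poly_(i < m) f i.

Lemma fps_mulE (f g : fps) (m n : nat) : (n < m)%N ->
  fps_mul f g n = (fps_trunc m f * fps_trunc m g)`_n.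
Proof.
move=> nm; rewrite coefM; apply: eq_bigr => i _; rewrite !coef_poly.
by rewrite (leq_ltn_trans _ nm) ?leq_ord // (leq_ltn_trans (leq_subr _ _) nm).
Qed.

Lemma fps_truncM (f g : fps) (m i : nat) : (i < m)%N ->
  (fps_trunc m (fps_mul f g))`_i = (fps_trunc m f * fps_trunc m g)`_i.
Proof. by move=> im; rewrite coef_poly im -fps_mulE. Qed.

Lemma fps_mulC : commutative fps_mul.
Proof.
by move=> f g; apply/funext => n; rewrite !(fps_mulE _ _ (ltnSn n)) mulrC.
Qed.

Lemma fps_mulA : associative fps_mul.
Proof.
move=> f g h; apply/funext => n; rewrite !(fps_mulE _ _ (ltnSn n)).
transitivity ((fps_trunc n.+1 f * fps_trunc n.+1 g * fps_trunc n.+1 h)`_n).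
  rewrite -mulrA !coefM; apply: eq_bigr => i _.
  by rewrite fps_truncM // ltnS leq_subr.
by rewrite !coefM; apply: eq_bigr => i _; rewrite fps_truncM.
Qed.

Lemma fps_mul1 : left_id fps1 fps_mul.
Proof.
move=> f; apply/funext => n; rewrite /fps_mul big_ord_recl /= /fps1 eqxx mul1r.
by rewrite subn0 big1 ?addr0 // => i _; rewrite mul0r.
Qed.

Lemma fps_mulDl : left_distributive fps_mul (fun f g : fps => f + g).
Proof.
move=> f g h; apply/funext => n.
change (fps_mul (f + g) h n = fps_mul f h n + fps_mul g h n).
rewrite /fps_mul -big_split /=; apply: eq_bigr => i _.
by rewrite [(f + g) i](_ : _ = f i + g i) // mulrDl.
Qed.

Lemma fps1_neq0 : fps1 != 0 :> fps.
Proof. by apply/eqP => /(congr1 (fun f : fps => f 0%N)). Qed.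

HB.instance Definition _ := GRing.Zmodule_isComNzRing.Build fps
  fps_mulA fps_mulC fps_mul1 fps_mulDl fps1_neq0.

Definition fps_unit : {pred fps} := fun f => `[< exists g : fps, g * f = 1 >].

Definition fps_inv (f : fps) : fps := xget f [set g | g * f = 1].

Lemma fps_mulV : {in fps_unit, left_inverse 1 fps_inv *%R}.
Proof. by move=> f /asboolP[g gf]; exact: (xgetPex f (ex_intro (fun h => h * f = 1) g gf)). Qed.

Lemma fps_unitPl (f g : fps) : g * f = 1 -> f \in fps_unit.
Proof. by move=> gf; apply/asboolP; exists g. Qed.

Lemma fps_inv_out : {in [predC fps_unit], fps_inv =1 id}.
Proof.
move=> f; rewrite inE => /negP nf; apply: xgetPN => g gf; apply: nf.
exact: fps_unitPl gf.
Qed.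

HB.instance Definition _ := GRing.ComNzRing_hasMulInverse.Build fps
  fps_mulV fps_unitPl fps_inv_out.

Definition fpsq : fps := fun n => (n == 1%N)%:R.

(* q-adic (coefficientwise) convergence *)
Definition fps_cvg (u : nat -> fps) (f : fps) : Prop :=
  forall n, exists N, forall m, (N <= m)%N -> u m n = f n.

(* 0 if u does not converge *)
Definition fps_lim (u : nat -> fps) : fps := xget 0 [set f | fps_cvg u f].

(* (a; x)_oo *)
Definition qpoch (a x : fps) : fps :=
  fps_lim (fun N => \prod_(i < N) (1 - a * x ^+ i)).

(* Only finitely many members of the family contribute to each coefficient. *)
Definition fps_summable (T : choiceType) (A : set T) (F : T -> fps) : Prop :=
  forall n, finite_set [set p | A p /\ F p n != 0].

(* Meaningful for summable families only: [\sum_(p \in A)] is 0 on an infinite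
   support. *)
Definition fps_sum (T : choiceType) (A : set T) (F : T -> fps) : fps :=
  fun n => \sum_(p \in A) F p n.

Definition fps_has_sum (T : choiceType) (A : set T) (F : T -> fps) (f : fps) :
  Prop := fps_summable A F /\ fps_sum A F = f.

(* Iterated sum: over each fibre of [c] first, then over the values of [c]. It
   gives a meaning to sums over [partitions] that are not summable: when r = 0
   every partition (1, ..., 1) contributes +1 or -1 to the constant coefficient
   (see [not_summable_r0]). For a summable family it is the ordinary sum. *)
Definition fps_has_sum_by (T : choiceType) (c : T -> nat) (A : set T)
    (F : T -> fps) (f : fps) : Prop :=
  (forall k, fps_summable [set p | A p /\ c p = k] F) /\
  fps_has_sum [set: nat] (fun k => fps_sum [set p | A p /\ c p = k] F) f.

Definition partitions : set (seq nat) :=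
  [set p | sorted geq p /\ 0%N \notin p].

Definition distinct_partitions : set (seq nat) :=
  [set p | partitions p /\ uniq p].

(* [nth 0 p i] is the part lambda_(i+1), so the odd-indexed parts lambda_1,
   lambda_3, ... sit at even positions i. *)
Definition ceilO (p : seq nat) : nat :=
  (\sum_(i < size p | ~~ odd i) uphalf (nth 0 p i))%N.
Definition floorO (p : seq nat) : nat :=
  (\sum_(i < size p | ~~ odd i) (nth 0 p i)./2)%N.
Definition ceilE (p : seq nat) : nat :=
  (\sum_(i < size p | odd i) uphalf (nth 0 p i))%N.
Definition floorE (p : seq nat) : nat :=
  (\sum_(i < size p | odd i) (nth 0 p i)./2)%N.

(* (-1)^ceilE eps^floorE q^(r ceilO + t floorO + s floorE) *)
Definition term (r t s : nat) (eps : int) (p : seq nat) : fps :=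
  (-1) ^+ ceilE p * eps%:~R ^+ floorE p
  * fpsq ^+ (r * ceilO p + t * floorO p + s * floorE p).

(* The operations are total; the following show that the values used are the
   intended ones. *)

Lemma fps0M (f g : fps) : (f * g) 0%N = f 0%N * g 0%N.
Proof. by rewrite /GRing.mul /= /fps_mul big_ord1. Qed.

Lemma fps_expr_lt (x : fps) (k n : nat) :
  x 0%N = 0 -> (n < k)%N -> (x ^+ k) n = 0.
Proof.
move=> x0; elim: k n => [//|k IHk] n nk; rewrite exprS.
rewrite [LHS](_ : _ = fps_mul x (x ^+ k) n) // /fps_mul big1 // => i _.
case: i => [[|i] /= ilt]; first by rewrite x0 mul0r.
rewrite IHk ?mulr0 //; rewrite ltnS in ilt.
by rewrite -subSn // subSS (leq_trans (leq_subr _ _)).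
Qed.

Lemma fps_mul_expr_lt (a x : fps) (k n : nat) :
  x 0%N = 0 -> (n < k)%N -> (a * x ^+ k) n = 0.
Proof.
move=> x0 nk; rewrite [LHS](_ : _ = fps_mul a (x ^+ k) n) // /fps_mul.
rewrite big1 // => i _; rewrite fps_expr_lt ?mulr0 //.
exact: leq_ltn_trans (leq_subr _ _) nk.
Qed.

Lemma fps_lim_cvg (u : nat -> fps) (f : fps) : fps_cvg u f -> fps_lim u = f.
Proof.
move=> uf; apply: xget_unique => // g ug; apply/funext => n.
have [N1 h1] := uf n; have [N2 h2] := ug n.
by rewrite -(h1 (maxn N1 N2)) ?leq_maxl // -(h2 (maxn N1 N2)) ?leq_maxr.
Qed.

Lemma qpoch_cvg (a x : fps) : x 0%N = 0 ->
  fps_cvg (fun N => \prod_(i < N) (1 - a * x ^+ i)) (qpoch a x).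
Proof.
move=> x0; set u := fun N : nat => _.
have stab n m : (n.+1 <= m)%N -> u m n = u n.+1 n.
  elim: m => // m IHm; rewrite leq_eqVlt => /predU1P[->//|]; rewrite ltnS => nm.
  rewrite -IHm // {1}/u big_ord_recr /= -/(u m) mulrBr mulr1 mulrA.
  have -> : (u m - u m * a * x ^+ m) n = u m n - (u m * a * x ^+ m) n by [].
  by rewrite fps_mul_expr_lt // subr0.
have cu : fps_cvg u (fun n => u n.+1 n) by move=> n; exists n.+1; exact: stab.
by rewrite /qpoch -/u (fps_lim_cvg cu).
Qed.

Lemma fps_unit_coef0 (f : fps) : f 0%N = 1 -> f \is a GRing.unit.
Proof.
move=> f0; pose h : fps := 1 - f.
have h0 : h 0%N = 0 by rewrite [LHS](_ : _ = 1 - f 0%N) // f0 subrr.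
pose s N : fps := \sum_(i < N) h ^+ i.
have sf N : s N * f = 1 - h ^+ N.
  have -> : f = 1 - h by rewrite /h subKr.
  by rewrite mulrC -opprB mulNr -subrX1 opprB.
have stab n m : (n.+1 <= m)%N -> s m n = s n.+1 n.
  elim: m => // m IHm; rewrite leq_eqVlt => /predU1P[->//|]; rewrite ltnS => nm.
  rewrite -IHm // {1}/s big_ord_recr /= -/(s m).
  have -> : (s m + h ^+ m) n = s m n + (h ^+ m) n by [].
  by rewrite fps_expr_lt // addr0.
have gf : ((fun n => s n.+1 n) : fps) * f = 1.
  apply/funext => n; rewrite [LHS](_ : _ = (s n.+1 * f) n); last first.
    by apply: eq_bigr => i _; rewrite (@stab i n.+1) // ltnS -ltnS.
  rewrite sf [LHS](_ : _ = (1 : fps) n - (h ^+ n.+1) n) //.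
  by rewrite fps_expr_lt // subr0.
exact: fps_unitPl gf.
Qed.

Lemma qpoch_unit (a x : fps) : a 0%N = 0 -> x 0%N = 0 ->
  qpoch a x \is a GRing.unit.
Proof.
move=> a0 x0; apply: fps_unit_coef0; have [N h] := qpoch_cvg a x0 0%N.
rewrite -(h N) //; elim: N {h} => [|N IHN]; first by rewrite big_ord0.
rewrite big_ord_recr /= fps0M IHN mul1r.
rewrite [LHS](_ : _ = 1 - (a * x ^+ N) 0%N) // fps0M a0 mul0r.
by rewrite subr0.
Qed.

Lemma not_summable_r0 (t s : nat) (eps : int) :
  ~ fps_summable partitions (term 0 t s eps).
Proof.
move=> /(_ 0%N) fin.
suff : finite_set [set: nat] by exact: infinite_nat.
apply: (@sub_finite_set _ _ ((fun n => nseq n 1%N) @^-1`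
   [set p | partitions p /\ term 0 t s eps p 0%N != 0])); last first.
  apply: finite_preimage => //= m n _ _ /(congr1 size).
  by rewrite !size_nseq.
move=> n _ /=; split.
  split; last by rewrite mem_nseq negb_and orbT.
  by elim: n => //= -[|n].
have half0 (P : pred nat) :
    (\sum_(i < size (nseq n 1) | P i) (nth 0 (nseq n 1) i)./2 = 0)%N.
  by apply: big1 => i _; rewrite nth_nseq; case: ifP.
rewrite /term /floorO /floorE (half0 odd) (half0 (predC odd)).
rewrite mul0n !muln0 !expr0 !mulr1.
by rewrite -signr_odd; case: odd; rewrite ?expr1 ?expr0.
Qed.

(* Main.v *)
(* Weigh a partition by a^ceilO b^floorO c^ceilE d^floorE. Removing the largest
   part exchanges (a, b) with (c, d), so the generating function F_N of the
   partitions with parts at most N and the one G_N with exchanged weights satisfy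
   a pair of linear recursions in N. For c = -1 they have closed solutions, in
   which G_N = 0 for odd N. With x = abcd = -abd:
     distinct parts: F_(2j) = prod_(i < j) (1 + a x^i), G_(2j) = (-d)^j F_(2j);
     all partitions: F_(2j) = prod_(1 <= i <= j) 1 / (1 - x^i),
                     G_(2j) = (-d)^j F_(2j).
   In the second case the sums need not converge, so they are graded by the
   exponent k of a, which makes every sum finite: the part of degree k of F_(2j)
   is x^k times the number of partitions of k into parts at most j. *)
Require Import Defs.
From mathcomp Require Import all_boot all_order all_algebra.
From mathcomp Require Import all_classical.
From mathcomp Require Import zify ring.
Import GRing.Theory.
Local Open Scope classical_set_scope.
Local Open Scope ring_scope.

(** * Effect of removing the first part on the four statistics *)

Lemma ceilO_cons h p : ceilO (h :: p) = (uphalf h + ceilE p)%N.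
Proof.
rewrite /ceilO /ceilE big_mkcond big_ord_recl /= [in RHS]big_mkcond.
by congr (_ + _)%N; apply: eq_bigr => i _; rewrite /= negbK.
Qed.

Lemma ceilE_cons h p : ceilE (h :: p) = ceilO p.
Proof.
rewrite /ceilO /ceilE big_mkcond big_ord_recl /= add0n [in RHS]big_mkcond.
exact: eq_bigr.
Qed.

Lemma floorO_cons h p : floorO (h :: p) = (h./2 + floorE p)%N.
Proof.
rewrite /floorO /floorE big_mkcond big_ord_recl /= [in RHS]big_mkcond.
by congr (_ + _)%N; apply: eq_bigr => i _; rewrite /= negbK.
Qed.

Lemma floorE_cons h p : floorE (h :: p) = floorO p.
Proof.
rewrite /floorO /floorE big_mkcond big_ord_recl /= add0n [in RHS]big_mkcond.
exact: eq_bigr.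
Qed.

(** Each part, being positive, adds at least 1 to its ceiling sum, and the two index classes differ
    in size by at most one. So fixing one ceiling sum bounds the length, the source of finiteness
    below. *)
Lemma size_le_ceil p : 0%N \notin p ->
  (size p <= (ceilO p).*2)%N /\ (size p <= (ceilE p).*2.+1)%N.
Proof.
elim: p => //= h p IHp; rewrite in_cons negb_or => /andP[h0 /IHp[hO hE]].
by rewrite ceilO_cons ceilE_cons; split; lia.
Qed.

Lemma floorO_le_ceilO p : (floorO p <= ceilO p)%N.
Proof. by apply: leq_sum => i _; lia. Qed.

(** * Partitions with bounded parts *)

Definition bounded (N : nat) (p : seq nat) : bool := all (geq N) p.

Lemma bounded_trans M N p : (M <= N)%N -> bounded M p -> bounded N p.
Proof. by move=> MN; apply: sub_all => i /= iM; exact: leq_trans MN. Qed.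

Lemma geq_trans : transitive geq.
Proof. by move=> x y z /= yx zy; exact: leq_trans zy yx. Qed.

Lemma partitions_cons h p :
  partitions (h :: p) <-> [/\ (0 < h)%N, bounded h p & partitions p].
Proof.
rewrite /partitions /= (path_sortedE geq_trans) in_cons negb_or eq_sym.
rewrite lt0n; split.
  by case=> /andP[bp sp] /andP[h0 p0].
by case=> -> bp [-> ->]; rewrite andbT.
Qed.

Lemma distinct_partitions_cons h p :
  distinct_partitions (h.+1 :: p) <-> bounded h p /\ distinct_partitions p.
Proof.
rewrite /distinct_partitions /= partitions_cons; split.
  case=> -[_ bp pp] /andP[hp up]; split=> //.
  apply/allP => i ip; have := allP bp i ip.
  rewrite /= leq_eqVlt => /predU1P[ih|//].
  by rewrite -ih ip in hp.
case=> bp [pp ->]; split; [split=> //|rewrite andbT].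
  exact: bounded_trans bp.
by apply/negP => /(allP bp); rewrite /= ltnn.
Qed.

Lemma bounded0 p : partitions p -> bounded 0 p -> p = [::].
Proof.
by case: p => // h p /partitions_cons[h0 _ _] /= /andP[]; case: h h0.
Qed.

Lemma bounded_ceilO p : partitions p -> bounded (ceilO p).*2 p.
Proof.
case: p => // h p /partitions_cons[_ bp _]; rewrite ceilO_cons.
rewrite /bounded /=; apply/andP; split; first by lia.
by apply: bounded_trans bp; lia.
Qed.

(** The largest part h is at most 2 floor(h/2) + 1. This variant serves the case r = 0, where
    [ceilO] does not enter the exponent of q. *)
Lemma bounded_floorO p : partitions p -> bounded (floorO p).*2.+1 p.
Proof.
case: p => // h p /partitions_cons[_ bp _]; rewrite floorO_cons.
rewrite /bounded /=; apply/andP; split; first by lia.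
by apply: bounded_trans bp; lia.
Qed.

(** The tail after a first part N + 1 may contain N + 1 again, so the recursions for all partitions
    have level N + 1 on both sides, unlike those for distinct parts. *)
Lemma partitions_boundedS N p :
  (partitions p /\ bounded N.+1 p) <->
  (partitions p /\ bounded N p) \/
  exists2 p', partitions p' /\ bounded N.+1 p' & N.+1 :: p' = p.
Proof.
split.
  case=> pp; case: p pp => [|h p pp]; first by left.
  rewrite /bounded /= leq_eqVlt => /andP[/predU1P[hN|hN] bp].
    right; exists p; rewrite -?hN //; split; first by case/partitions_cons: pp.
    by rewrite hN.
  left; split=> //; rewrite -ltnS hN /=.
  by case/partitions_cons: pp => _ hp _; exact: bounded_trans hp.
case=> [[pp bp]|[p' [pp bp] <-]]; split=> //.
- exact: bounded_trans bp.
- exact/partitions_cons.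
- by rewrite /bounded /= leqnn.
Qed.

Lemma distinct_boundedS N p :
  (distinct_partitions p /\ bounded N.+1 p) <->
  (distinct_partitions p /\ bounded N p) \/
  exists2 p', distinct_partitions p' /\ bounded N p' & N.+1 :: p' = p.
Proof.
split.
  case=> -[pp up] bp.
  case/partitions_boundedS: (conj pp bp) => [[_ b]|[p' _ e]]; first by left.
  right; exists p' => //; move: pp up; rewrite -e => pp up.
  by case/distinct_partitions_cons: (conj pp up).
case=> [[pp bp]|[p' [pp bp] <-]]; split=> //.
- exact: bounded_trans bp.
- exact/distinct_partitions_cons.
- by rewrite /bounded /= leqnn; exact: bounded_trans bp.
Qed.

Lemma finite_bounded_size m N :
  finite_set [set p : seq nat | (size p <= m)%N /\ bounded N p].
Proof.
apply: (@sub_finite_set _ _ ((fun p : m.-bseq 'I_N.+1 => map val p) @` setT)).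
  move=> p /= [sp bp].
  have sp' : (size (map (@inord N) p) <= m)%N by rewrite size_map.
  exists (Bseq sp') => //=; rewrite -map_comp -[RHS]map_id.
  by apply/eq_in_map => i ip /=; rewrite inordK // ltnS; exact: (allP bp).
exact/finite_image/finite_finset.
Qed.

(** * The four-parameter weight and its recursion *)

Definition boulet {R : comNzRingType} (a b c d : R) (p : seq nat) : R :=
  a ^+ ceilO p * b ^+ floorO p * c ^+ ceilE p * d ^+ floorE p.

(** Boulet's weight is the product of cell labels a, b, a, b, ... in odd-indexed rows and c, d, c,
    d, ... in even-indexed rows; removing the first row exchanges the two kinds of rows. *)
Lemma boulet_cons (R : comNzRingType) (a b c d : R) h p :
  boulet a b c d (h :: p) = a ^+ uphalf h * b ^+ h./2 * boulet c d a b p.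
Proof.
by rewrite /boulet ceilO_cons ceilE_cons floorO_cons floorE_cons !exprD; ring.
Qed.

Lemma boulet_nil (R : comNzRingType) (a b c d : R) : boulet a b c d [::] = 1.
Proof.
by rewrite /boulet /ceilO /floorO /ceilE /floorE !big_ord0 !expr0 !mulr1.
Qed.

(** Common source of all recursions in N, with h = N + 1: [B] collects the partitions not starting
    with h, [C] the tails of the others. *)
Lemma sum_split_head (R : comNzRingType) (A B C : set (seq nat)) h (a b c d : R) :
  finite_set B -> finite_set C -> (forall p, B p -> ~ (exists p', h :: p' = p)) ->
  (forall p, A p <-> B p \/ exists2 p', C p' & h :: p' = p) ->
  \sum_(p \in A) boulet a b c d p = \sum_(p \in B) boulet a b c d p
   + a ^+ uphalf h * b ^+ h./2 * \sum_(p \in C) boulet c d a b p.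
Proof.
move=> fB fC dis HA.
have -> : A = B `|` cons h @` C by apply/seteqP; split=> p /HA.
rewrite fsbigU0 //; [|exact: finite_image|]; last first.
  by move=> p /= [/dis np [p' _ e]]; apply: np; exists p'.
congr (_ + _); rewrite fsbig_image; last by move=> p p' _ _ [].
rewrite !fsbig_finite // big_distrr /=; apply: eq_bigr => p _.
exact: boulet_cons.
Qed.

(** * Generating functions for distinct parts *)

Definition dist_upto N : set (seq nat) :=
  [set p | distinct_partitions p /\ bounded N p].

Lemma finite_dist_upto N : finite_set (dist_upto N).
Proof.
apply: sub_finite_set (finite_bounded_size N.+1 N) => p [[_ up] bp]; split=> //.
rewrite -(size_iota 0 N.+1); apply: uniq_leq_size up _ => i /(allP bp) iN.
by rewrite mem_iota.
Qed.

Lemma sum_dist_uptoS (R : comNzRingType) (a b c d : R) N :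
  \sum_(p \in dist_upto N.+1) boulet a b c d p =
  \sum_(p \in dist_upto N) boulet a b c d p
   + a ^+ uphalf N.+1 * b ^+ N.+1./2 * \sum_(p \in dist_upto N) boulet c d a b p.
Proof.
apply: sum_split_head; try exact: finite_dist_upto.
  by move=> p [_ bp] [p' e]; move: bp; rewrite -e /bounded /= ltnn.
exact: distinct_boundedS.
Qed.

Lemma sum_dist_upto0 (R : comNzRingType) (a b c d : R) :
  \sum_(p \in dist_upto 0) boulet a b c d p = 1.
Proof.
rewrite (_ : dist_upto 0 = [set [::]]) ?fsbig_set1 ?boulet_nil //.
by apply/seteqP; split=> [p [[pp _] /bounded0->]|p ->].
Qed.

(* The induction closes because the swapped sum over [dist_upto N] vanishes for
   odd [N]. *)
Lemma sum_dist_upto_even (R : comNzRingType) (a b d : R) j :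
  \sum_(p \in dist_upto j.*2) boulet a b (-1) d p =
    \prod_(i < j) (1 + a * (- (a * b * d)) ^+ i) /\
  \sum_(p \in dist_upto j.*2) boulet (-1) d a b p =
    (- d) ^+ j * \prod_(i < j) (1 + a * (- (a * b * d)) ^+ i).
Proof.
elim: j => [|j [IF IG]].
  by rewrite double0 !sum_dist_upto0 big_ord0 expr0 mulr1.
have F1 : \sum_(p \in dist_upto j.*2.+1) boulet a b (-1) d p =
    \prod_(i < j.+1) (1 + a * (- (a * b * d)) ^+ i).
  (* The added term is a^(j+1) b^j (-d)^j F_(2j) = a x^j F_(2j), with x = -abd. *)
  rewrite sum_dist_uptoS IF IG /= uphalf_double doubleK big_ord_recr /=.
  set P := \prod_(i < j) _.
  rewrite (_ : - (a * b * d) = a * b * - d) ?exprMn ?exprS; last by ring.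
  by rewrite mulrDr mulr1; congr (_ + _); ring.
(* The added term (-1)^(j+1) d^j F_(2j) cancels G_(2j) = (-d)^j F_(2j). *)
have G1 : \sum_(p \in dist_upto j.*2.+1) boulet (-1) d a b p = 0.
  rewrite sum_dist_uptoS IF IG /= uphalf_double doubleK.
  by rewrite [(- d) ^+ j]exprNn exprS; ring.
rewrite doubleS 2!(sum_dist_uptoS _ _ _ _ _ j.*2.+1) F1 G1 /=.
by rewrite uphalf_double doubleK mulr0 addr0 add0r [(- d) ^+ _]exprNn.
Qed.

(** * Generating functions for all partitions, degree by degree *)

Definition part_upto (f : seq nat -> nat) N k : set (seq nat) :=
  [set p | (partitions p /\ bounded N p) /\ f p = k].

Lemma finite_part_uptoO N k : finite_set (part_upto ceilO N k).
Proof.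
apply: sub_finite_set (finite_bounded_size k.*2 N) => p [[[_ p0] bp] <-].
by split=> //; case: (size_le_ceil p p0).
Qed.

Lemma finite_part_uptoE N k : finite_set (part_upto ceilE N k).
Proof.
apply: sub_finite_set (finite_bounded_size k.*2.+1 N) => p [[[_ p0] bp] <-].
by split=> //; case: (size_le_ceil p p0).
Qed.

Lemma part_upto_not_cons f N k p :
  part_upto f N k p -> ~ (exists p', N.+1 :: p' = p).
Proof.
by move=> [[_ bp] _] [p' e]; move: bp; rewrite -e /bounded /= ltnn.
Qed.

(** A first part N + 1 alone would already push [ceilO] above k. *)
Lemma sum_part_uptoOS_lt (R : comNzRingType) (a b c d : R) N k :
  (k < uphalf N.+1)%N ->
  \sum_(p \in part_upto ceilO N.+1 k) boulet a b c d p =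
  \sum_(p \in part_upto ceilO N k) boulet a b c d p.
Proof.
move=> kN; apply: eq_fsbigl; apply/seteqP; split=> p [pp pk]; split=> //.
  case/partitions_boundedS: pp => // -[p' _ e].
  by move: kN; rewrite -pk -e ceilO_cons; lia.
by apply/partitions_boundedS; left.
Qed.

(** The exponent of a is [ceilO] on the left and [ceilE] in the exchanged weight. The degree drops
    strictly, so induction on it copes with level N + 1 on the right. *)
Lemma sum_part_uptoOS (R : comNzRingType) (a b c d : R) N k :
  \sum_(p \in part_upto ceilO N.+1 (uphalf N.+1 + k)) boulet a b c d p =
  \sum_(p \in part_upto ceilO N (uphalf N.+1 + k)) boulet a b c d p
   + a ^+ uphalf N.+1 * b ^+ N.+1./2
     * \sum_(p \in part_upto ceilE N.+1 k) boulet c d a b p.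
Proof.
apply: sum_split_head; [exact: finite_part_uptoO|exact: finite_part_uptoE| |].
  exact: part_upto_not_cons.
move=> p; split.
  case=> /partitions_boundedS[pp pk|[p' pp <-]]; first by left.
  by rewrite ceilO_cons => /addnI pk; right; exists p'.
case=> [[pp pk]|[p' [pp pk] <-]]; split=> //.
- by apply/partitions_boundedS; left.
- by apply/partitions_boundedS; right; exists p'.
- by rewrite ceilO_cons pk.
Qed.

(** [ceilE] does not see the removed first part, so the degree stays k. *)
Lemma sum_part_uptoES (R : comNzRingType) (a b c d : R) N k :
  \sum_(p \in part_upto ceilE N.+1 k) boulet a b c d p =
  \sum_(p \in part_upto ceilE N k) boulet a b c d p
   + a ^+ uphalf N.+1 * b ^+ N.+1./2
     * \sum_(p \in part_upto ceilO N.+1 k) boulet c d a b p.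
Proof.
apply: sum_split_head; [exact: finite_part_uptoE|exact: finite_part_uptoO| |].
  exact: part_upto_not_cons.
move=> p; split.
  case=> /partitions_boundedS[pp pk|[p' pp <-]]; first by left.
  by rewrite ceilE_cons => pk; right; exists p'.
case=> [[pp pk]|[p' [pp pk] <-]]; split=> //.
- by apply/partitions_boundedS; left.
- by apply/partitions_boundedS; right; exists p'.
- by rewrite ceilE_cons pk.
Qed.

Lemma sum_part_upto0 (R : comNzRingType) (a b c d : R) f k :
  f [::] = 0%N ->
  \sum_(p \in part_upto f 0 k) boulet a b c d p = (k == 0%N)%:R.
Proof.
move=> f0; case: k => [|k] /=.
  rewrite (_ : part_upto f 0 0 = [set [::]]) ?fsbig_set1 ?boulet_nil //.
  by apply/seteqP; split=> [p [[pp /bounded0->//]]|p ->].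
by rewrite fsbig1 // => p [[pp /bounded0->//]]; rewrite f0.
Qed.

(** * Power series coefficients and partition numbers with bounded parts *)

Lemma fpsD (f g : fps) n : (f + g) n = f n + g n. Proof. by []. Qed.
Lemma fpsB (f g : fps) n : (f - g) n = f n - g n. Proof. by []. Qed.
Lemma fpsM (f g : fps) n : (f * g) n = \sum_(i < n.+1) f i * g (n - i)%N.
Proof. by []. Qed.

Lemma fps_sumE (I : Type) (s : seq I) (P : pred I) (F : I -> fps) n :
  (\sum_(i <- s | P i) F i) n = \sum_(i <- s | P i) F i n.
Proof. by elim/big_rec2: _ => // i x y _ <-. Qed.

Lemma fpsqM (f : fps) n : (fpsq * f) n = if n is m.+1 then f m else 0.
Proof.
rewrite fpsM; case: n => [|n]; first by rewrite big_ord1 mul0r.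
rewrite 2!big_ord_recl big1 /= ?addr0.
  by rewrite /fpsq /= mul0r add0r mul1r subSS subn0.
by move=> i _; rewrite /fpsq /= mul0r.
Qed.

Lemma fpsqXM (f : fps) d n :
  (fpsq ^+ d * f) n = if (d <= n)%N then f (n - d)%N else 0.
Proof.
elim: d n => [|d IHd] n; first by rewrite expr0 mul1r subn0.
by rewrite exprS -mulrA fpsqM; case: n => // n; rewrite IHd subSS.
Qed.

(* The coefficient of q^k counts the partitions of k into parts at most j. *)
Definition part_fps (j : nat) : fps := (\prod_(i < j) (1 - fpsq ^+ i.+1))^-1.

Lemma part_fps0 k : part_fps 0 k = (k == 0%N)%:R.
Proof. by rewrite /part_fps big_ord0 invr1. Qed.

(** A partition into parts at most j + 1 either has no part j + 1 or loses one; algebraically, the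
    last factor is cleared. *)
Lemma part_fps_rec j : part_fps j.+1 = part_fps j + fpsq ^+ j.+1 * part_fps j.+1.
Proof.
have u i : (1 - fpsq ^+ i.+1 : fps) \is a GRing.unit.
  by apply: fps_unit_coef0; rewrite fpsB fps_expr_lt // subr0.
apply/eqP; rewrite -subr_eq -[X in X - _]mul1r -mulrBl; apply/eqP.
rewrite /part_fps big_ord_recr /= invrM ?mulVKr //.
by apply: rpred_prod => i _; exact: u.
Qed.

Lemma part_fpsS_lt j k : (k < j.+1)%N -> part_fps j.+1 k = part_fps j k.
Proof. by move=> kj; rewrite part_fps_rec fpsD fpsqXM leqNgt kj addr0. Qed.

Lemma part_fpsS j k :
  part_fps j.+1 (j.+1 + k)%N = part_fps j (j.+1 + k)%N + part_fps j.+1 k.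
Proof. by rewrite {1}part_fps_rec fpsD fpsqXM leq_addr addKn. Qed.

(** No part of a partition of k exceeds k, so the diagonal values are the ordinary partition
    numbers. *)
Lemma part_fps_stable j k : (k <= j)%N -> part_fps j k = part_fps k k.
Proof.
elim: j => [|j IHj]; first by rewrite leqn0 => /eqP->.
by rewrite leq_eqVlt => /predU1P[->//|kj]; rewrite part_fpsS_lt // IHj.
Qed.

(** The outer induction is on j. Inside each level a strong induction on the degree resolves the
    recursions that have the same level on both sides. *)
Lemma sum_part_upto_even (R : comNzRingType) (a b d : R) j k :
  \sum_(p \in part_upto ceilO j.*2 k) boulet a b (-1) d p =
    (part_fps j k)%:~R * (- (a * b * d)) ^+ k /\
  \sum_(p \in part_upto ceilE j.*2 k) boulet (-1) d a b p =
    (- d) ^+ j * (part_fps j k)%:~R * (- (a * b * d)) ^+ k.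
Proof.
elim: j k => [|j IHj] k.
  rewrite double0 !sum_part_upto0 ?part_fps0; try by rewrite ?/ceilO ?/ceilE big_ord0.
  by rewrite expr0 mul1r; case: k => [|k]; rewrite ?mulr1 ?mul0r.
have odd1 i : \sum_(p \in part_upto ceilO j.*2.+1 i) boulet a b (-1) d p =
    (part_fps j i)%:~R * (- (a * b * d)) ^+ i /\
  \sum_(p \in part_upto ceilE j.*2.+1 i) boulet (-1) d a b p = 0.
  have [n] := ubnP i; elim: n i => // n IHn i ni.
  have F1 : \sum_(p \in part_upto ceilO j.*2.+1 i) boulet a b (-1) d p =
    (part_fps j i)%:~R * (- (a * b * d)) ^+ i.
    have [ij|ji] := ltnP i (uphalf j.*2.+1).
      by rewrite sum_part_uptoOS_lt //; case: (IHj i).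
    (* The extra term carries G_(2j+1) in degree i - (j + 1), zero by the inner induction. *)
    rewrite -(subnKC ji) sum_part_uptoOS (IHn _ _).2 ?mulr0 ?addr0.
      by case: (IHj (uphalf j.*2.+1 + (i - uphalf j.*2.+1))%N).
    by move: ji ni; rewrite /= doubleK; lia.
  (* Here too (-1)^(j+1) d^j cancels (-d)^j. *)
  split=> //; rewrite sum_part_uptoES F1 (IHj i).2 /= uphalf_double doubleK.
  by rewrite [(- d) ^+ j]exprNn exprS; ring.
have ev i : \sum_(p \in part_upto ceilE j.*2.+2 i) boulet (-1) d a b p =
   (- d) ^+ j.+1 * \sum_(p \in part_upto ceilO j.*2.+2 i) boulet a b (-1) d p.
  rewrite sum_part_uptoES (odd1 i).2 add0r /=.
  by rewrite uphalf_double doubleK [(- d) ^+ _]exprNn.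
have F2 : \sum_(p \in part_upto ceilO j.*2.+2 k) boulet a b (-1) d p =
    (part_fps j.+1 k)%:~R * (- (a * b * d)) ^+ k.
  have [n] := ubnP k; elim: n k => // n IHn i ni.
  have h2 : uphalf j.*2.+2 = j.+1 by rewrite /= uphalf_double.
  have [ij|ji] := ltnP i j.+1.
    by rewrite sum_part_uptoOS_lt ?h2 // (odd1 i).1 part_fpsS_lt.
  rewrite -(subnKC ji) -{1}h2 sum_part_uptoOS h2 ev (odd1 _).1.
  rewrite IHn; last by lia.
  (* The prefactor (ab)^(j+1) (-d)^(j+1) is x^(j+1) with x = -abd, so the recursion becomes that of
     [part_fps]. *)
  rewrite part_fpsS intrD /= doubleK mulrDl; congr (_ + _).
  rewrite (_ : - (a * b * d) = a * b * - d) ?exprD ?exprMn; last by ring.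
  by ring.
by rewrite doubleS ev F2 mulrA.
Qed.

(** * Coefficientwise limits and sums over fibres *)

Lemma fps_cvg_upto u f n : fps_cvg u f ->
  exists N, forall m, (N <= m)%N -> forall i, (i <= n)%N -> u m i = f i.
Proof.
move=> uf; elim: n => [|n [N IHn]].
  by have [N uN] := uf 0%N; exists N => m /uN um i; rewrite leqn0 => /eqP->.
have [N' uN] := uf n.+1; exists (maxn N N') => m.
rewrite geq_max => /andP[/IHn um /uN um'] i.
by rewrite leq_eqVlt => /predU1P[->//|]; exact: um.
Qed.

Lemma fps_mul_agree (f f' g g' : fps) n :
  (forall i, (i <= n)%N -> f i = f' i) -> (forall i, (i <= n)%N -> g i = g' i) ->
  (f * g) n = (f' * g') n.
Proof.
move=> ff' gg'; rewrite !fpsM; apply: eq_bigr => i _.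
by rewrite ff' ?gg' ?leq_subr // -ltnS.
Qed.

Lemma fps_sum_finite (T : choiceType) (A : set T) (F : T -> fps) :
  finite_set A -> fps_sum A F = \sum_(p \in A) F p.
Proof.
move=> fA; apply/funext => n.
by rewrite /fps_sum !fsbig_finite // fps_sumE.
Qed.

Lemma fsum_seqE (T : choiceType) (V : nmodType) (A : set T) (s : seq T)
    (f : T -> V) :
  uniq s -> (forall i, i \in s -> A i) ->
  (forall i, A i -> i \notin s -> f i = 0) ->
  \sum_(i \in A) f i = \sum_(i <- s) f i.
Proof.
move=> us sA f0; rewrite [RHS]fsbig_seq //; apply/esym/fsbig_widen => //.
by move=> i /= [Ai /negP]; exact: f0.
Qed.

(** In each coefficient the support is a finite list, on which the two summations can be
    exchanged. *)
Lemma fps_has_sum_fibres (T : choiceType) (c : T -> nat) (A : set T)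
    (F : T -> fps) (f : fps) :
  fps_summable A F -> fps_has_sum_by c A F f -> fps_has_sum A F f.
Proof.
move=> sF [_ [_ <-]]; split=> //; apply/funext => n.
have /finite_seqP[s0 Es0] := sF n.
pose s := undup s0.
have us : uniq s by exact: undup_uniq.
have Es p : (p \in s) <-> A p /\ F p n != 0.
  by rewrite mem_undup; have := congr1 (@^~ p) Es0 => /= ->.
rewrite /fps_sum.
rewrite (@fsum_seqE _ _ _ s) //; last 2 first.
- by move=> p /Es[].
- by move=> p Ap ps; apply/eqP; apply: contraNT ps => ?; apply/Es.
have inner k : \sum_(p \in [set p | A p /\ c p = k]) F p n =
    \sum_(p <- s | c p == k) F p n.
  rewrite -[RHS]big_filter; apply: fsum_seqE.
  - exact: filter_uniq.
  - by move=> p /=; rewrite mem_filter => /andP[/eqP cp /Es[]].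
  - move=> p [Ap cp]; rewrite mem_filter cp eqxx /= => ps.
    by apply/eqP; apply: contraNT ps => ?; apply/Es.
under [RHS]eq_fsbigr do rewrite inner.
rewrite [RHS](@fsum_seqE _ _ _ (undup (map c s))) ?undup_uniq //; last first.
  move=> k _; rewrite mem_undup => ks; rewrite big1_seq // => p /andP[/eqP cp ps].
  by case/negP: ks; rewrite -cp map_f.
(* After the exchange, each p meets exactly one k, namely [c p]. *)
rewrite (exchange_big_dep predT) //= big_seq [RHS]big_seq.
apply: eq_bigr => p ps.
rewrite (eq_bigl (pred1 (c p))); last by move=> k; exact: eq_sym.
by rewrite -big_filter filter_pred1_uniq ?undup_uniq ?mem_undup ?map_f // big_seq1.
Qed.

(** * Euler's product for the partition generating function *)

Definition part_series (x : fps) (j K : nat) : fps :=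
  \sum_(k < K) (part_fps j k)%:~R * x ^+ k.

(** Truncation errors are recorded as multiples of x^K, which keeps these identities valid for every
    x; convergence enters only in the limit. *)
Lemma part_series_tail (x : fps) j K d :
  exists h, part_series x j (d + K) = part_series x j K + h * x ^+ K.
Proof.
elim: d => [|d [h IHd]]; first by exists 0; rewrite mul0r addr0.
exists (h + (part_fps j (d + K)%N)%:~R * x ^+ d).
by rewrite addSn [LHS]big_ord_recr /= -/(part_series x j _) IHd exprD; ring.
Qed.

Lemma part_series_rec (x : fps) j K :
  part_series x j.+1 (j.+1 + K) =
  part_series x j (j.+1 + K) + x ^+ j.+1 * part_series x j.+1 K.
Proof.
elim: K => [|K IHK].
  rewrite addn0 [part_series _ _ 0]big_ord0 mulr0 addr0; apply: eq_bigr => k _.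
  by rewrite part_fpsS_lt.
rewrite addnS [LHS]big_ord_recr [part_series x j _]big_ord_recr.
rewrite [part_series x j.+1 K.+1]big_ord_recr /=.
by rewrite -!/(part_series _ _ _) IHK part_fpsS intrD exprD; ring.
Qed.

Lemma part_series_factor (x : fps) j K :
  exists h, part_series x j.+1 K * (1 - x ^+ j.+1) =
    part_series x j K + h * x ^+ K.
Proof.
have [Kj|/ltnW jK] := leqP K j.+1.
  (* All coefficients used have index below j + 1, where j and j + 1 agree, and x^(j+1) is a
     multiple of x^K. *)
  have -> : part_series x j.+1 K = part_series x j K.
    by apply: eq_bigr => k _; rewrite part_fpsS_lt // (leq_trans (ltn_ord k)).
  by exists (- part_series x j K * x ^+ (j.+1 - K));
    rewrite -{1}(subnK Kj) exprD; ring.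
rewrite -(subnKC jK); move: (K - j.+1)%N => m.
(* The recursion leaves x^(j+1) times the sum cut at m = K - (j + 1); the cut costs a multiple of
   x^(j+1) x^m = x^K. *)
have [h Eh] := part_series_tail x j.+1 m j.+1.
exists (- h); rewrite mulrBr mulr1 {1}part_series_rec Eh exprD.
by ring.
Qed.

(** Each factor lowers j by one, down to j = 0, where only the term k = 0 survives; the cut at K + 1
    ensures that it is present. *)
Lemma part_series_prod (x : fps) j K :
  exists h, part_series x j K.+1 * \prod_(i < j) (1 - x * x ^+ i) =
    1 + h * x ^+ K.+1.
Proof.
elim: j => [|j [h IHj]].
  exists 0; rewrite big_ord0 mulr1 mul0r addr0 [LHS]big_ord_recl part_fps0 mul1r.
  by rewrite big1 ?addr0 // => i _; rewrite part_fps0 mul0r.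
have [h' Eh'] := part_series_factor x j K.+1.
move: IHj; rewrite big_ord_recr /= -exprS; set P := \prod_(i < j) _ => IHj.
exists (h + h' * P); rewrite mulrA mulrAC Eh' mulrDl IHj.
by ring.
Qed.

(** Up to degree n, both the sum and the product agree with finite versions at a large j, whose
    product is 1 up to a multiple of x^(n+1). *)
Lemma has_sum_part_series (x : fps) : x 0%N = 0 ->
  fps_has_sum [set: nat] (fun k => (part_fps k k)%:~R * x ^+ k)
    (qpoch x x)^-1.
Proof.
move=> x0; split=> [n|].
  apply: sub_finite_set (finite_II n.+1) => k /= [_]; apply: contraR.
  by rewrite -leqNgt => nk; apply/eqP/fps_mul_expr_lt.
set S := fps_sum _ _.
have SE i n j : (i <= n)%N -> (n <= j)%N -> S i = part_series x j n.+1 i.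
  move=> le_in nj; rewrite /part_series fps_sumE.
  transitivity (\sum_(k < n.+1) ((part_fps k k)%:~R * x ^+ k : fps) i).
    rewrite (fsbig_ord _ _ (fun k => ((part_fps k k)%:~R * x ^+ k : fps) i)).
    apply/esym/fsbig_widen => //= k [_ /negP]; rewrite -leqNgt => nk.
    exact: fps_mul_expr_lt x0 (leq_ltn_trans le_in nk).
  apply: eq_bigr => k _; rewrite (part_fps_stable j) // (leq_trans _ nj) //.
  by rewrite -ltnS.
have uq := qpoch_unit x0 x0.
suff S1 : S * qpoch x x = 1 by rewrite -[LHS](mulrK uq) S1 mul1r.
apply/funext => n; have [N HN] := fps_cvg_upto _ _ n (qpoch_cvg x x0).
(* Beyond N the product has settled up to degree n; beyond n the partition numbers have. *)
pose j := maxn N n.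
rewrite (@fps_mul_agree _ (part_series x j n.+1) _ (\prod_(i < j) (1 - x * x ^+ i))).
- have [h ->] := part_series_prod x j n.
  by rewrite fpsD fps_mul_expr_lt // addr0.
- by move=> i le_in; rewrite (SE _ n j) // leq_maxr.
- by move=> i le_in; rewrite HN // leq_maxl.
Qed.

(** * Specialization of the weights to powers of q *)

Lemma termE r t s eps p : term r t s eps p =
  boulet (fpsq ^+ r) (fpsq ^+ t) (-1) (eps%:~R * fpsq ^+ s) p.
Proof. by rewrite /term /boulet exprMn !exprD !exprM; ring. Qed.

Lemma term_coef_neq0 r t s eps p n : term r t s eps p n != 0 ->
  (r * ceilO p + t * floorO p + s * floorE p <= n)%N.
Proof. by apply: contraR; rewrite -ltnNge => ?; apply/eqP/fps_mul_expr_lt. Qed.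

(** The largest part is at most twice [ceilO], so the closed form at level 2k, with j = k, covers
    all of degree k. *)
Lemma partitions_ceilO k :
  [set p | partitions p /\ ceilO p = k] = part_upto ceilO k.*2 k.
Proof.
apply/seteqP; split=> p; last by case=> -[].
by case=> pp pk; do 2?split=> //; rewrite -pk; exact: bounded_ceilO.
Qed.

Theorem theorem4p9 (r t s : nat) (eps : int)
    (hrt : (0 < r + t)%N) (heps : eps = 1 \/ eps = -1) :
  let x : fps := - eps%:~R * fpsq ^+ (r + t + s) in
  [/\ fps_has_sum distinct_partitions (term r t s eps) (qpoch (- fpsq ^+ r) x),
      (0 < r)%N ->
        fps_has_sum partitions (term r t s eps) (qpoch x x)^-1
    & r = 0%N ->
        fps_has_sum_by ceilO partitions (term r t s eps) (qpoch x x)^-1].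
Proof.
move=> x.
have x0 : x 0%N = 0 by apply: fps_mul_expr_lt; rewrite // addn_gt0 hrt.
have xE : x = - (fpsq ^+ r * fpsq ^+ t * (eps%:~R * fpsq ^+ s)).
  by rewrite /x !exprD; ring.
(* Proved for every r: it is the claim for r = 0, and summability turns it into the claim for r >
   0. *)
have byceil : fps_has_sum_by ceilO partitions (term r t s eps) (qpoch x x)^-1.
  split=> [k n|].
    rewrite -/(finite_set _); apply: sub_finite_set (finite_part_uptoO k.*2 k).
    by rewrite -partitions_ceilO => p [].
  rewrite (_ : (fun k => _) = fun k => (part_fps k k)%:~R * x ^+ k).
    exact: has_sum_part_series.
  apply/funext => k; rewrite partitions_ceilO fps_sum_finite; last first.
    exact: finite_part_uptoO.
  under eq_fsbigr do rewrite termE.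
  rewrite xE.
  by case: (sum_part_upto_even _ (fpsq ^+ r) (fpsq ^+ t) (eps%:~R * fpsq ^+ s) k k).
split=> // [|r0].
  (* As r + t > 0 and [floorO] is at most [ceilO], the exponent bounds [floorO] by n; parts are then
     at most 2n + 1, rounded up to an even level. *)
  have supp p n : distinct_partitions p -> term r t s eps p n != 0 ->
      dist_upto n.+1.*2 p.
    move=> dp /term_coef_neq0 pn; split=> //.
    apply: bounded_trans (bounded_floorO _ dp.1).
    by have := floorO_le_ceilO p; nia.
  split=> [n|].
    by apply: sub_finite_set (finite_dist_upto n.+1.*2) => p [dp]; exact: supp.
  apply/funext => n; have [N HN] := qpoch_cvg (- fpsq ^+ r) x0 n.
  (* Large enough for the product to settle and for level 2j to contain the support. *)
  pose j := maxn N n.+1.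
  rewrite -(HN j) ?leq_maxl //.
  rewrite /fps_sum -(@fsbig_widen _ _ _ _ (dist_upto j.*2)); last 2 first.
  - by move=> p [].
  - move=> p [dp np] /=; apply/eqP; apply: contra_notT np => /(supp _ _ dp)[_ bp].
    by split=> //; apply: bounded_trans bp; rewrite leq_double leq_maxr.
  rewrite -/(fps_sum _ _ n) fps_sum_finite; last exact: finite_dist_upto.
  under eq_fsbigr do rewrite termE.
  rewrite (sum_dist_upto_even _ _ _ _ j).1 -xE; congr (_ n).
  by apply: eq_bigr => i _; rewrite mulNr opprK.
apply: fps_has_sum_fibres byceil => n.
(* For r > 0 the exponent bounds [ceilO] by n, hence both the length and the parts by 2n. *)
apply: sub_finite_set (finite_bounded_size n.*2 n.*2) => p [pp] /term_coef_neq0 pn.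
have pn' : (ceilO p <= n)%N.
  by apply: leq_trans pn; rewrite -addnA (leq_trans _ (leq_addr _ _)) ?leq_pmull.
split.
  by apply: leq_trans (size_le_ceil p pp.2).1 _; rewrite leq_double.
by apply: bounded_trans (bounded_ceilO _ pp); rewrite leq_double.
Qed.
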